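(* Let $G$ be a Lie group endowed with a fixed right-invariant Riemannian metric $\langle\cdot,\cdot\rangle_G$. For finite $I\subset\mathbb N$ let $$g_I=\sum_{i\in I}dx_i^2+\sum_{i\in I}x_i^2\,\langle\cdot,\cdot\rangle_G^{(i)}\quad\text{on } S_I\times G^I,$$ where $\langle\cdot,\cdot\rangle_G^{(i)}$ is the metric on the $i$-th copy of $G$. Then the family $(g_I)_I$ defines a global (possibly degenerate) metric $g$ on $E^{\mathrm{sph}}(G)$; that is, there is a well-defined assignment to each plot $p:U\to E^{\mathrm{sph}}(G)$ of a symmetric covariant $2$-tensor $p^*g$ on $U$, compatible with smooth reparametrizations, given by $(p^*g)|_V=\widetilde p^{\,*}g_I$ whenever $p|_V=\psi_I\circ\widetilde p$ with $V\subset U$ open, $I$ finite and $\widetilde p:V\to S_I\times G^I$ smooth.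
   Context: Spherical Milnor space: $E^{\mathrm{sph}}(G)$ is the set of families $(x_i,g_i)_{i\in\mathbb N}$ with $x_i\in\mathbb R$ finitely supported, $\sum_i x_i^2=1$, $g_i\in G$, modulo $(x_i,g_i)\sim(x_i,g_i')$ iff $g_i=g_i'$ whenever $x_i\ne0$. For finite $I\subset\mathbb N$, $S_I=\{x\in\mathbb R^I:\sum_{i\in I}x_i^2=1\}$ (with subset diffeology of $\mathbb R^I$) and $\psi_I:S_I\times G^I\to E^{\mathrm{sph}}(G)$ is extension by zero followed by passage to the quotient. $E^{\mathrm{sph}}(G)$ carries the final diffeology generated by the $\psi_I$: a map $p:U\to E^{\mathrm{sph}}(G)$ ($U$ open in a Euclidean space) is a plot iff locally $p=\psi_I\circ\widetilde p$ for some finite $I$ and some smooth $\widetilde p$ with values in $S_I\times G^I$. The term $\sum_{i\in I}dx_i^2$ denotes the restriction to $S_I$ of the Euclidean metric. *)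

(* Defs.v *)
From HB Require Import structures.
From mathcomp Require Import all_boot all_order all_algebra generic_quotient finmap.
From mathcomp Require Import all_classical all_reals all_analysis.

Set Implicit Arguments.
Unset Strict Implicit.
Unset Printing Implicit Defensive.

Import Order.TTheory GRing.Theory Num.Theory.
Import numFieldNormedType.Exports.

Local Open Scope classical_set_scope.
Local Open Scope ring_scope.
Local Open Scope quotient_scope.

(* Maps and tensor fields on an open subset U of R^n are represented by total
   functions on 'rV[R]_n; only their values on U are meaningful. *)

Fixpoint Ck (R : realType) (n : nat) (W : normedModType R) (k : nat)
    (U : set 'rV[R]_n) (f : 'rV[R]_n -> W) : Prop :=
  if k is k'.+1 then
    (forall u, U u -> differentiable f u) /\
    (forall v : 'rV[R]_n, Ck k' U (fun u => 'd f u v))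
  else forall u, U u -> {for u, continuous f}.

Definition smooth (R : realType) (n : nat) (W : normedModType R)
    (U : set 'rV[R]_n) (f : 'rV[R]_n -> W) : Prop :=
  forall k, Ck k U f.

Definition symmetric_bilinear (R : realType) (n : nat)
    (b : 'rV[R]_n -> 'rV[R]_n -> R) : Prop :=
  (forall (a : R) (v v' w : 'rV[R]_n), b (a *: v + v') w = a * b v w + b v' w) /\
  (forall v w : 'rV[R]_n, b v w = b w v).

Definition tensor_field (R : realType) (n : nat) : Type :=
  'rV[R]_n -> 'rV[R]_n -> 'rV[R]_n -> R.

Definition symmetric_2tensor (R : realType) (n : nat) (U : set 'rV[R]_n)
    (T : tensor_field R n) : Prop :=
  (forall u, U u -> symmetric_bilinear (T u)) /\
  (forall v w : 'rV[R]_n, smooth U (fun u => T u v w)).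

(* chart_map is meaningful on chart_dom only, and chart_inv on chart_img. *)
Record chart (R : realType) (d : nat) (M : topologicalType) := Chart {
  chart_dom : set M ;
  chart_map : M -> 'rV[R]_d ;
  chart_inv : 'rV[R]_d -> M ;
  chart_dom_open : open chart_dom ;
  chart_img_open : open (chart_map @` chart_dom) ;
  chart_mapK : forall q, chart_dom q -> chart_inv (chart_map q) = q ;
  chart_map_continuous :
    forall q, chart_dom q -> {for q, continuous chart_map} ;
  chart_inv_continuous :
    forall y, (chart_map @` chart_dom) y -> {for y, continuous chart_inv}
}.

Definition chart_img (R : realType) (d : nat) (M : topologicalType)
    (c : chart R d M) : set 'rV[R]_d := chart_map c @` chart_dom c.

(* chart_at selects one chart of the atlas around each point; it serves to
   identify the tangent space at that point with R^d. *)
HB.mixin Record isManifold (R : realType) (d : nat) M of Topological M := {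
  atlas : set (chart R d M) ;
  chart_at : M -> chart R d M ;
  chart_at_atlas : forall q, atlas (chart_at q) ;
  chart_at_dom : forall q, chart_dom (chart_at q) q ;
  atlas_compatible : forall a b : chart R d M, atlas a -> atlas b ->
    smooth (chart_map a @` (chart_dom a `&` chart_dom b))
      (chart_map b \o chart_inv a) ;
  manifold_hausdorff : hausdorff_space M ;
  manifold_second_countable : @second_countable M
}.

#[short(type="manifoldType")]
HB.structure Definition Manifold (R : realType) (d : nat) :=
  { M of Topological M & isManifold R d M }.

HB.mixin Record isLieGroup (R : realType) (d : nat) G
    of Manifold R d G & Group G := {
  mulg_continuous : continuous (fun z : G * G => (z.1 * z.2)%g) ;
  mulg_smooth : forall a b c : chart R d G, atlas a -> atlas b -> atlas c ->
    smooth
      [set z : 'rV[R]_(d + d) |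
        [/\ chart_img a (lsubmx z), chart_img b (rsubmx z)
          & chart_dom c (chart_inv a (lsubmx z) * chart_inv b (rsubmx z))%g]]
      (fun z => chart_map c (chart_inv a (lsubmx z) * chart_inv b (rsubmx z))%g) ;
  invg_continuous : continuous (fun x : G => (x^-1)%g) ;
  invg_smooth : forall a b : chart R d G, atlas a -> atlas b ->
    smooth [set y | chart_img a y /\ chart_dom b (chart_inv a y)^-1%g]
      (fun y => chart_map b (chart_inv a y)^-1%g)
}.

#[short(type="lieGroupType")]
HB.structure Definition LieGroup (R : realType) (d : nat) :=
  { G of Manifold R d G & Group G & isLieGroup R d G }.

(* The tangent space at q, in the coordinates of the chart chart_at q. *)
Definition tangent (R : realType) (d : nat) (M : manifoldType R d) (q : M) :
  Type := 'rV[R]_d.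

Definition smooth_into (R : realType) (d : nat) (M : manifoldType R d) (n : nat)
    (U : set 'rV[R]_n) (f : 'rV[R]_n -> M) : Prop :=
  (forall u, U u -> {for u, continuous f}) /\
  (forall c : chart R d M, atlas c ->
    smooth (U `&` f @^-1` chart_dom c) (chart_map c \o f)).

Definition differential_into (R : realType) (d : nat) (M : manifoldType R d)
    (n : nat) (f : 'rV[R]_n -> M) (u v : 'rV[R]_n) : tangent (f u) :=
  'd (chart_map (chart_at (f u)) \o f) u v.

Definition differential (R : realType) (d d' : nat) (M : manifoldType R d)
    (N : manifoldType R d') (f : M -> N) (q : M) (v : tangent q) :
    tangent (f q) :=
  'd (chart_map (chart_at (f q)) \o f \o chart_inv (chart_at q))
     (chart_map (chart_at q) q) v.

(* Smoothness is that of the local expression of the metric in each chart c,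
   that is, of its pullback by the local parametrization chart_inv c. *)
Record riemannian_metric (R : realType) (d : nat) (M : manifoldType R d) :=
RiemannianMetric {
  metric : forall q : M, tangent q -> tangent q -> R ;
  metric_bilinear : forall q : M, @symmetric_bilinear R d (@metric q) ;
  metric_posdef : forall (q : M) (v : 'rV[R]_d), v != 0 -> 0 < @metric q v v ;
  metric_smooth : forall c : chart R d M, atlas c ->
    symmetric_2tensor (chart_img c)
      (fun y v w => @metric (chart_inv c y)
        (differential_into (chart_inv c) y v)
        (differential_into (chart_inv c) y w))
}.

Definition right_invariant (R : realType) (d : nat) (G : lieGroupType R d)
    (m : riemannian_metric G) : Prop :=
  forall (h q : G) (v w : tangent q),
    metric m (differential (fun x : G => (x * h)%g) v)
             (differential (fun x : G => (x * h)%g) w) = metric m v w.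

Section SphericalMilnorSpace.
Variables (R : realType) (G : groupType).

Record milnor_family := MilnorFamily {
  family_coord : nat -> R ;
  family_elt : nat -> G ;
  family_finite_support : finite_set [set i | family_coord i != 0] ;
  family_sphere : \sum_(i \in [set: nat]) family_coord i ^+ 2 = 1
}.

HB.instance Definition _ := gen_eqMixin milnor_family.
HB.instance Definition _ := gen_choiceMixin milnor_family.

Definition milnor_equiv (a b : milnor_family) : bool :=
  `[< family_coord a = family_coord b /\
      forall i, family_coord a i != 0 -> family_elt a i = family_elt b i >].

Lemma milnor_equiv_refl : reflexive milnor_equiv.
Proof. by move=> a; apply/asboolP; split. Qed.

Lemma milnor_equiv_sym : symmetric milnor_equiv.
Proof.
move=> a b; apply: asbool_equiv_eq; split=> -[eqx eqg]; split=> // i xi.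
  by rewrite eqg // eqx.
by rewrite eqg // eqx.
Qed.

Lemma milnor_equiv_trans : transitive milnor_equiv.
Proof.
move=> b a c /asboolP[eab gab] /asboolP[ebc gbc]; apply/asboolP.
by split=> [|i xi]; [rewrite eab | rewrite gab // gbc // -eab].
Qed.

Canonical milnor_equiv_rel :=
  EquivRel milnor_equiv milnor_equiv_refl milnor_equiv_sym milnor_equiv_trans.

Definition milnor_sphere : Type := {eq_quot milnor_equiv_rel}.

Record sphere (I : {fset nat}) := Sphere {
  sphere_coord :> I -> R ;
  sphere_eq : \sum_(i : I) sphere_coord i ^+ 2 = 1
}.

Definition extend (T : Type) (z : T) (I : {fset nat}) (f : I -> T) (n : nat) : T :=
  if insub n is Some i then f i else z.

Lemma extend_finite_support (I : {fset nat}) (x : I -> R) :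
  finite_set [set i | extend 0 x i != 0].
Proof.
apply: (sub_finite_set _ (finite_fset I)) => i /=.
by rewrite /extend; case: insubP => [j -> //|]; rewrite eqxx.
Qed.

Lemma extend_sphere (I : {fset nat}) (x : sphere I) :
  \sum_(i \in [set: nat]) extend 0 x i ^+ 2 = 1.
Proof.
rewrite -(sphere_eq x) (fsbigE (enum_fset I)) ?fset_uniq//.
  rewrite big_mkcond big_seq_fsetE/=; apply: eq_bigr => i _.
  by rewrite in_setT /extend valK.
move=> i _ iI; rewrite /extend; case: insubP => [j jI|_]; last by rewrite expr0n.
by move: iI; rewrite jI.
Qed.

(* The entries of the second family outside I are irrelevant after passing to
   the quotient, since the corresponding coordinates vanish. *)
Definition psi (I : {fset nat}) (z : sphere I * (I -> G)) : milnor_sphere :=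
  \pi_({eq_quot milnor_equiv_rel})
    (MilnorFamily (extend 1%g z.2) (extend_finite_support z.1)
       (extend_sphere z.1)).

End SphericalMilnorSpace.

Section SphericalMetric.
Variables (R : realType) (d : nat) (G : lieGroupType R d).

(* Smooth maps for the subset diffeology of S_I in R^I and the product
   diffeology. *)
Definition smooth_lift (n : nat) (V : set 'rV[R]_n) (I : {fset nat})
    (q : 'rV[R]_n -> sphere R I * (I -> G)) : Prop :=
  (forall i : I, smooth V (fun u => (q u).1 i)) /\
  (forall i : I, smooth_into V (fun u => (q u).2 i)).

Definition plot (n : nat) (U : set 'rV[R]_n)
    (p : 'rV[R]_n -> milnor_sphere R G) : Prop :=
  open U /\
  forall u, U u -> exists (V : set 'rV[R]_n) (I : {fset nat})
      (q : 'rV[R]_n -> sphere R I * (I -> G)),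
    [/\ open V, V u, V `<=` U, smooth_lift V q
      & forall t, V t -> p t = psi (q t)].

(* Tangent vectors at z are pairs (xi, eta) with xi a vector of R^I tangent to
   the sphere and eta i tangent to G at z.2 i; the metric is defined by the same
   formula on all xi. *)
Definition product_tangent (I : {fset nat}) (z : sphere R I * (I -> G)) : Type :=
  ((I -> R) * (forall i : I, tangent (z.2 i)))%type.

Definition product_metric (m : riemannian_metric G) (I : {fset nat})
    (z : sphere R I * (I -> G)) (v w : product_tangent z) : R :=
  \sum_(i : I) v.1 i * w.1 i +
  \sum_(i : I) z.1 i ^+ 2 * metric m (v.2 i) (w.2 i).

Definition lift_differential (n : nat) (I : {fset nat})
    (q : 'rV[R]_n -> sphere R I * (I -> G)) (u v : 'rV[R]_n) :
    product_tangent (q u) :=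
  (fun i : I => 'd (fun t => (q t).1 i) u v,
   fun i : I => differential_into (fun t => (q t).2 i) u v).

Definition pullback_metric (m : riemannian_metric G) (n : nat) (I : {fset nat})
    (q : 'rV[R]_n -> sphere R I * (I -> G)) : tensor_field R n :=
  fun u v w =>
    product_metric m (lift_differential q u v) (lift_differential q u w).

Definition plot_assignment : Type :=
  forall n : nat, set 'rV[R]_n -> ('rV[R]_n -> milnor_sphere R G) ->
  tensor_field R n.

Definition tensorial (g : plot_assignment) : Prop :=
  forall (n : nat) (U : set 'rV[R]_n) (p : 'rV[R]_n -> milnor_sphere R G),
    plot U p -> symmetric_2tensor U (g n U p).

Definition reparametrization_compatible (g : plot_assignment) : Prop :=
  forall (n k : nat) (U : set 'rV[R]_n) (W : set 'rV[R]_k)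
      (p : 'rV[R]_n -> milnor_sphere R G) (f : 'rV[R]_k -> 'rV[R]_n),
    plot U p -> open W -> smooth W f -> f @` W `<=` U ->
    forall u, W u -> forall v w : 'rV[R]_k,
      g k W (p \o f) u v w = g n U p (f u) ('d f u v) ('d f u w).

Definition restricts_to_pullback (m : riemannian_metric G)
    (g : plot_assignment) : Prop :=
  forall (n : nat) (U V : set 'rV[R]_n) (p : 'rV[R]_n -> milnor_sphere R G)
      (I : {fset nat}) (q : 'rV[R]_n -> sphere R I * (I -> G)),
    plot U p -> open V -> V `<=` U -> smooth_lift V q ->
    (forall t, V t -> p t = psi (q t)) ->
    forall u, V u -> forall v w : 'rV[R]_n,
      g n U p u v w = pullback_metric m q u v w.

End SphericalMetric.

(* Main.v *)
Require Import Defs.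
From HB Require Import structures.
From mathcomp Require Import all_boot all_order all_algebra generic_quotient finmap.
From mathcomp Require Import all_classical all_reals all_analysis.

Set Implicit Arguments.
Unset Strict Implicit.
Unset Printing Implicit Defensive.

Import Order.TTheory GRing.Theory Num.Theory.
Import numFieldNormedType.Exports.

Local Open Scope classical_set_scope.
Local Open Scope ring_scope.

(** Near a point u of U, a plot p can have several lifts q : V -> S_I x G^I, and
the value at u of the pullback of g_I by q must depend on p alone.  Two lifts of
p represent, at each t near u, the same element of the quotient.  So they have
the same coordinates x_n(t), extended by zero outside of the index sets, and the
same group elements g_n(t) for each n such that x_n(t) <> 0.  Therefore:
- the sum of the dx_n^2 is the same for both lifts, since it involves only the
  differentials of the functions x_n;
- in the sum of the x_n^2 <dg_n, dg_n>, the terms with x_n(u) = 0 vanish, and if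
  x_n(u) <> 0 then by continuity x_n <> 0 near u, so that the two maps g_n
  coincide near u and have the same differential at u.
The factor x_n^2 thus kills exactly the terms on which the lifts may disagree;
this is [pullback_metric_unique].

The tensor attached to p is then the common value of the pullbacks
([milnor_metric], [milnor_metricE]).  The other properties are local, and each
of them reduces to one lift.  Smoothness is [pullback_metric_tensor], whose main
point [smooth_metric_along] is that a Riemannian metric is smooth along a smooth
map; compatibility with reparametrizations is the chain rule
([pullback_metric_comp]), a lift of p o f being q o f; and uniqueness holds
because each plot has a lift near each point. *)

(** * Differentials: locality and products *)

Section Differential.
Variables (R : realType) (V W : normedModType R).

Lemma near_eq_continuous (T : topologicalType) (f g : V -> T) (x : V) :
  (\forall t \near x, f t = g t) -> {for x, continuous f} ->
  {for x, continuous g}.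
Proof.
move=> fg; rewrite /prop_for /continuous_at (nbhs_singleton fg).
by move=> fx; apply: cvg_trans fx; apply: near_eq_cvg; apply: filterS fg.
Qed.

(** The differential is defined by a choice among all linear maps, so that its
locality has to be derived from the uniqueness of the differential. *)
Lemma near_eq_diff (f g : V -> W) (x : V) :
  (\forall t \near x, f t = g t) -> differentiable f x ->
  differentiable g x /\ 'd g x = 'd f x :> (V -> W).
Proof.
move=> fg df; have fgx := nbhs_singleton fg; have [dfc /eqaddoP dfo] := (diff_locallyP _ _).1 df.
have dgo : g \o shift x = cst (g x) + 'd f x +o_ 0 id.
  apply/eqaddoP => e e0; have := dfo e e0; move: fg; rewrite (near_shift 0).
  rewrite /= => fg; apply: filterS2 fg => t /=; rewrite /= subr0 => fgt.
  by rewrite !fctE /= fgt fgx.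
have dgf : 'd g x = 'd f x :> (V -> W) by exact: diff_unique.
split; last exact: dgf.
by apply/diff_locallyP; split; rewrite dgf; [exact: dfc | exact: dgo].
Qed.

Lemma diff_linear_comp (W' : normedModType R) (l : {linear W -> W'})
    (f : V -> W) (x v : V) :
  continuous l -> differentiable f x ->
  differentiable (l \o f) x /\ 'd (l \o f) x v = l ('d f x v).
Proof.
move=> cl df; have dl y : differentiable l y by exact: linear_differentiable.
split; first exact: differentiable_comp.
by rewrite diff_comp //= diff_lin.
Qed.

(** The Leibniz rule, as the differential of the bilinear map (r, w) |-> r *: w
composed with (a, f). *)
Lemma diff_scale (a : V -> R) (f : V -> W) (x v : V) :
  differentiable a x -> differentiable f x ->
  differentiable (fun t => a t *: f t) x /\
  'd (fun t => a t *: f t) x v = a x *: 'd f x v + 'd a x v *: f x.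
Proof.
move=> da df.
have bil : bilinear_for
    (GRing.Scale.Law.clone _ _ *:%R _) (GRing.Scale.Law.clone _ _ *:%R _)
    (@GRing.scale R W).
  split=> [u'|u] b y z /=; first by rewrite scalerDl scalerA.
  by rewrite scalerDr !scalerA mulrC.
pose bM := bilinear_isBilinear.Build R R W W _ _ (@GRing.scale R W) bil.
pose b : {bilinear R -> W -> W} := HB.pack (@GRing.scale R W) bM.
have bc : continuous (fun p : R * W => b p.1 p.2).
  by move=> p; exact: scale_continuous.
have db := differentiable_bilin (a x, f x) bc.
have dp := differentiable_pair da df.
have eb := diff_bilin (a x, f x) bc.
have ep := diff_pair da df.
split; first exact: differentiable_comp dp db.
have -> := diff_comp dp db.

by rewrite (congr1 (fun h => (h \o _) v) eb) /= (congr1 (fun h => h v) ep).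
Qed.

End Differential.

(** * Closure properties of maps of class C^k *)

Section Ck.
Variables (R : realType) (n : nat).
Implicit Types (U V : set 'rV[R]_n) (k : nat).

Lemma open_preimage (T : topologicalType) U (D : set T)
    (f : 'rV[R]_n -> T) :
  open U -> open D -> (forall u, U u -> {for u, continuous f}) ->
  open (U `&` f @^-1` D).
Proof.
move=> oU oD fc; rewrite openE => u [Uu Du]; apply: filterI.
  exact: open_nbhs_nbhs.
by apply: (fc u Uu); exact: open_nbhs_nbhs.
Qed.

Lemma open_eq_diff (W : normedModType R) U (f g : 'rV[R]_n -> W) u :
  open U -> U u -> (forall t, U t -> f t = g t) -> differentiable f u ->
  differentiable g u /\ 'd g u = 'd f u :> ('rV[R]_n -> W).
Proof.
move=> oU Uu fg; apply: near_eq_diff.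
by apply: filterS (open_nbhs_nbhs (conj oU Uu)) => t /fg.
Qed.

Lemma Ck_eq (W : normedModType R) k U (f g : 'rV[R]_n -> W) :
  open U -> (forall u, U u -> f u = g u) -> Ck k U f -> Ck k U g.
Proof.
move=> oU; elim: k f g => [|k IH] f g fg /=.
  move=> fc u Uu; apply: near_eq_continuous (fc u Uu).
  exact: filterS fg (open_nbhs_nbhs (conj oU Uu)).
move=> [df Cf].
have dg u (Uu : U u) := open_eq_diff oU Uu fg (df u Uu).
split=> [u Uu|v]; first by case: (dg u Uu).
apply: IH (Cf v) => u Uu; exact: esym (congr1 (@^~ v) (dg u Uu).2).
Qed.

Lemma Ck_local (W : normedModType R) k U (f : 'rV[R]_n -> W) :
  (forall u, U u -> exists2 V, V u & Ck k V f) -> Ck k U f.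
Proof.
elim: k f => [|k IH] f loc /=; first by move=> u /loc[V Vu Cf]; exact: Cf.
split=> [u /loc[V Vu [df _]]|v]; first exact: df.
by apply: IH => u /loc[V Vu [_ Cf]]; exists V; last exact: Cf.
Qed.

Lemma Ck_sub (W : normedModType R) k U V (f : 'rV[R]_n -> W) :
  V `<=` U -> Ck k U f -> Ck k V f.
Proof. by move=> VU Cf; apply: Ck_local => u /VU Uu; exists U. Qed.

Lemma CkW (W : normedModType R) k U (f : 'rV[R]_n -> W) :
  Ck k.+1 U f -> Ck k U f.
Proof.
elim: k f => [|k IH] f [df Cf].
  by move=> u Uu; apply: differentiable_continuous; exact: df.
by split=> // v; exact: IH (Cf v).
Qed.

Lemma Ck_cst (W : normedModType R) k U (w : W) :
  Ck k U (fun=> w : W).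
Proof.
elim: k w => [|k IH] w /=; first by move=> u _; exact: cst_continuous.
split=> [u _|v]; first exact: differentiable_cst.
rewrite (_ : (fun u => _) = fun=> 0); first exact: IH.
by apply: funext => u; rewrite diff_cst.
Qed.

Lemma CkD (W : normedModType R) k U (f g : 'rV[R]_n -> W) :
  open U -> Ck k U f -> Ck k U g -> Ck k U (fun u => f u + g u).
Proof.
move=> oU; elim: k f g => [|k IH] f g /=.
  by move=> fc gc u Uu; apply: continuousD; [exact: fc | exact: gc].
move=> [df Cf] [dg Cg]; split=> [u Uu|v].
  by apply: differentiableD; [exact: df | exact: dg].
apply: Ck_eq (IH _ _ (Cf v) (Cg v)) => // u Uu.
exact: esym (congr1 (@^~ v) (diffD (df u Uu) (dg u Uu))).
Qed.

Lemma Ck_sum (W : normedModType R) k U (J : Type) (r : seq J)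
    (f : J -> 'rV[R]_n -> W) :
  open U -> (forall j, Ck k U (f j)) -> Ck k U (fun u => \sum_(j <- r) f j u).
Proof.
move=> oU Cf; elim: r => [|j r IH].
  by under [X in Ck _ _ X]eq_fun do rewrite big_nil; exact: Ck_cst.
by under [X in Ck _ _ X]eq_fun do rewrite big_cons; exact: CkD.
Qed.

Lemma Ck_scale (W : normedModType R) k U (a : 'rV[R]_n -> R)
    (f : 'rV[R]_n -> W) :
  open U -> Ck k U a -> Ck k U f -> Ck k U (fun u => a u *: f u).
Proof.
move=> oU; elim: k a f => [|k IH] a f Ca Cf.
  by move=> u Uu; apply: continuousZ; [exact: Ca | exact: Cf].
have [da Cda] := Ca; have [df Cdf] := Cf.
have dM u v (Uu : U u) := diff_scale v (da u Uu) (df u Uu).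
split=> [u Uu|v]; first by case: (dM u 0 Uu).
have CDv := CkD oU (IH _ _ (CkW Ca) (Cdf v)) (IH _ _ (Cda v) (CkW Cf)).
by apply: Ck_eq CDv => // u Uu; exact: esym (dM u v Uu).2.
Qed.

Lemma Ck_linear (W W' : normedModType R) (l : {linear W -> W'}) k U
    (f : 'rV[R]_n -> W) :
  open U -> continuous l -> Ck k U f -> Ck k U (l \o f).
Proof.
move=> oU cl; elim: k f => [|k IH] f /=.
  by move=> fc u Uu; apply: continuous_comp; [exact: fc | exact: cl].
move=> [df Cf]; have dl u v (Uu : U u) := diff_linear_comp v cl (df u Uu).
split=> [u Uu|v]; first by case: (dl u 0 Uu).
by apply: Ck_eq (IH _ (Cf v)) => // u Uu; exact: esym (dl u v Uu).2.
Qed.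

Lemma Ck_coord d k U (f : 'rV[R]_n -> 'rV[R]_d) (j : 'I_d) :
  open U -> Ck k U f -> Ck k U (fun u => f u 0 j).
Proof.
move=> oU; have lin : linear (fun N : 'rV[R]_d => N 0 j : R).
  by move=> a x y; rewrite !mxE.
pose lM := GRing.isLinear.Build _ _ _ _ _ lin.
pose l : {linear 'rV[R]_d -> R} := HB.pack (fun N : 'rV[R]_d => N 0 j : R) lM.
by apply: (@Ck_linear _ _ l); [exact: oU | exact: coord_continuous].
Qed.

End Ck.

(** Induction on k needs the derivative of h o f in the direction v as a
combination of functions to which the induction hypothesis applies.  The chain
rule gives 'd h (f u) ('d f u v), where the direction moves with u; expanding it
in the standard basis leaves the partial derivatives of h, each taken in a
fixed direction and composed with f. *)
Lemma Ck_comp (R : realType) (n d : nat) (W : normedModType R) k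
    (U : set 'rV[R]_n) (Y : set 'rV[R]_d) (f : 'rV[R]_n -> 'rV[R]_d)
    (h : 'rV[R]_d -> W) :
  open U -> (forall u, U u -> Y (f u)) -> Ck k U f -> Ck k Y h ->
  Ck k U (h \o f).
Proof.
move=> oU fUY; elim: k h => [|k IH] h Cf Ch.
  move=> u Uu; apply: continuous_comp; first exact: Cf.
  exact: Ch (fUY u Uu).
have [df Cdf] := Cf; have [dh Cdh] := Ch.
split=> [u Uu|v].
  by apply: differentiable_comp; [exact: df | exact: dh (fUY u Uu)].
have Csum : Ck k U (fun u =>
    \sum_(j < d) 'd f u v 0 j *: 'd h (f u) (delta_mx 0 j)).
  apply: Ck_sum => // j; apply: Ck_scale => //.
    exact: (Ck_coord j oU (Cdf v)).
  exact: (IH (fun y => 'd h y (delta_mx 0 j)) (CkW Cf) (Cdh _)).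
apply: Ck_eq Csum => // u Uu.
apply: etrans (esym (congr1 (@^~ v) (diff_comp (df u Uu) (dh _ (fUY u Uu))))).
rewrite /= [in RHS](row_sum_delta ('d f u v)) linear_sum.
by apply: eq_bigr => j _; rewrite linearZZ.
Qed.

(** * Smooth maps into a manifold and metrics along them *)

Lemma symmetric_bilinear_sum (R : realType) (d : nat)
    (b : 'rV[R]_d -> 'rV[R]_d -> R) (v w : 'rV[R]_d) :
  symmetric_bilinear b ->
  b v w = \sum_i \sum_j (v 0 i * w 0 j) * b (delta_mx 0 i) (delta_mx 0 j).
Proof.
move=> [bl bs].
have b0 x : b 0 x = 0.
  by have := bl (-1) 0 0 x; rewrite scaler0 addr0 mulN1r addNr.
have expand x y : b x y = \sum_i x 0 i * b (delta_mx 0 i) y.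
  rewrite {1}(row_sum_delta x); elim/big_rec2: _ => [|i r z _ <-]; first exact: b0.
  exact: bl.
rewrite expand; apply: eq_bigr => i _; rewrite bs expand mulr_sumr.
by apply: eq_bigr => j _; rewrite mulrA bs.
Qed.

Section Manifold.
Variables (R : realType) (d : nat) (M : manifoldType R d).
Implicit Types (c : chart R d M) (m : riemannian_metric M).

Lemma smooth_into_sub (n : nat) (U V : set 'rV[R]_n) (f : 'rV[R]_n -> M) :
  V `<=` U -> smooth_into U f -> smooth_into V f.
Proof.
move=> VU [fc fs]; split=> [u /VU|c Ac k]; first exact: fc.
by apply: Ck_sub (fs c Ac k) => u [/VU].
Qed.

Lemma smooth_into_differentiable (n : nat) (U : set 'rV[R]_n)
    (f : 'rV[R]_n -> M) c u :
  smooth_into U f -> U u -> atlas c -> chart_dom c (f u) ->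
  differentiable (chart_map c \o f) u.
Proof. by move=> [_ fs] Uu Ac cu; apply: (fs c Ac 1%N).1. Qed.

Lemma differential_into_near_eq (n : nat) (U : set 'rV[R]_n)
    (f f' : 'rV[R]_n -> M) u (v : 'rV[R]_n) :
  smooth_into U f -> U u -> (\forall t \near u, f t = f' t) ->
  differential_into f' u v = differential_into f u v :> 'rV[R]_d.
Proof.
move=> fs Uu ff'; rewrite /differential_into -(nbhs_singleton ff').
have df := smooth_into_differentiable fs Uu (chart_at_atlas _)
  (chart_at_dom (f u)).
apply: (congr1 (@^~ v) (near_eq_diff _ df).2).
by apply: filterS ff' => t /= ->.
Qed.

Lemma differential_into_comp (n k : nat) (U : set 'rV[R]_n)
    (f : 'rV[R]_n -> M) (h : 'rV[R]_k -> 'rV[R]_n) (s v : 'rV[R]_k) :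
  smooth_into U f -> U (h s) -> differentiable h s ->
  differential_into (f \o h) s v = differential_into f (h s) ('d h s v).
Proof.
move=> fs Uh dh.
have df := smooth_into_differentiable fs Uh (chart_at_atlas _)
  (chart_at_dom (f (h s))).
exact: (congr1 (@^~ v) (diff_comp dh df)).
Qed.

(** The differential of f is taken in the chart selected at f u, which changes
with u.  This is the change of coordinates to a chart c that can be kept fixed
near u. *)
Lemma differential_into_chart (n : nat) (U : set 'rV[R]_n)
    (f : 'rV[R]_n -> M) c u (v : 'rV[R]_n) :
  open U -> smooth_into U f -> U u -> atlas c -> chart_dom c (f u) ->
  differential_into f u v =
  differential_into (chart_inv c) (chart_map c (f u))
    ('d (chart_map c \o f) u v) :> 'rV[R]_d.
Proof.
move=> oU fs Uu Ac cu.
have dcf := smooth_into_differentiable fs Uu Ac cu.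
rewrite /differential_into (chart_mapK cu); set b := chart_at (f u).
have dbc : differentiable (chart_map b \o chart_inv c) ((chart_map c \o f) u).
  have [+ _] := atlas_compatible _ _ Ac (chart_at_atlas (f u)) 1%N.
  apply.
  by exists (f u) => //; split=> //; exact: chart_at_dom.
have nbf : \forall t \near u,
    ((chart_map b \o chart_inv c) \o (chart_map c \o f)) t
    = (chart_map b \o f) t.
  have oV := open_preimage oU (@chart_dom_open _ _ _ c) fs.1.
  have Vu : (U `&` f @^-1` chart_dom c) u by [].
  by apply: filterS (open_nbhs_nbhs (conj oV Vu)) => t [_ ct] /=; rewrite chart_mapK.
have dcomp := differentiable_comp dcf dbc.
apply: etrans (congr1 (@^~ v) (near_eq_diff nbf dcomp).2) _.
exact: (congr1 (@^~ v) (diff_comp dcf dbc)).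
Qed.

(** The tangent vectors have a type that depends on the base point; stating the
congruence with vectors of R^d avoids any transport. *)
Lemma metric_congr m (q q' : M) (v v' w w' : 'rV[R]_d) :
  q = q' -> v = v' -> w = w' ->
  @metric _ _ _ m q v w = @metric _ _ _ m q' v' w'.
Proof. by move=> -> -> ->. Qed.

(** In a fixed chart c around f u0, with y = c o f, the function is
T(y(u))(dy(v), dy(w)), where T is the expression of the metric in c.  Since T is
bilinear, this is a polynomial in the components of dy(v) and dy(w) and in the
coefficients of T composed with y, all of which are smooth. *)
Lemma smooth_metric_along m (n : nat) (U : set 'rV[R]_n)
    (f : 'rV[R]_n -> M) (v w : 'rV[R]_n) :
  open U -> smooth_into U f ->
  smooth U (fun u =>
    metric m (differential_into f u v) (differential_into f u w)).
Proof.
move=> oU fs k; apply: Ck_local => u0 Uu0.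
pose c := chart_at (f u0); have Ac : atlas c by exact: chart_at_atlas.
pose V := U `&` f @^-1` chart_dom c.
exists V; first by split=> //; exact: chart_at_dom.
have oV : open V by apply: open_preimage fs.1 => //; exact: chart_dom_open.
have Cf j : Ck j V (chart_map c \o f) by exact: fs.2.
have [Tb Ts] := metric_smooth m Ac.
pose T y x z := @metric _ _ _ m (chart_inv c y)
  (differential_into (chart_inv c) y x) (differential_into (chart_inv c) y z).
have Cd i x : Ck k V (fun u => 'd (chart_map c \o f) u x 0 i).
  by exact: (Ck_coord i oV ((Cf k.+1).2 x)).
have CT i j : Ck k V (fun u =>
    T (chart_map c (f u)) (delta_mx 0 i) (delta_mx 0 j)).
  apply: (Ck_comp oV _ (Cf k) (Ts (delta_mx 0 i) (delta_mx 0 j) k)).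
  by move=> u [_ cu]; exists (f u).
have CS : Ck k V (fun u => \sum_i \sum_j
    ('d (chart_map c \o f) u v 0 i * 'd (chart_map c \o f) u w 0 j) *
    T (chart_map c (f u)) (delta_mx 0 i) (delta_mx 0 j)).
  apply: (Ck_sum _ oV) => i; apply: (Ck_sum _ oV) => j.
  exact: Ck_scale oV (Ck_scale oV (Cd i v) (Cd j w)) (CT i j).
apply: Ck_eq CS => // u [Uu cu].
rewrite -(symmetric_bilinear_sum _ _ (Tb (chart_map c (f u)) _)); last first.
  by exists (f u).
apply: metric_congr; first exact: chart_mapK.
  exact/esym/(differential_into_chart v oU fs Uu Ac cu).
exact/esym/(differential_into_chart w oU fs Uu Ac cu).
Qed.

End Manifold.

(** * Families extended by zero *)

Section Extend.
Variables (T : Type) (z : T) (I : {fset nat}).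

Lemma extend_in (f : I -> T) n (nI : n \in I) : extend z f n = f [` nI]%fset.
Proof. by rewrite /extend insubT. Qed.

Lemma extend_out (f : I -> T) n : n \notin I -> extend z f n = z.
Proof. by move=> nI; rewrite /extend insubN. Qed.

End Extend.

Lemma sum_extend (R : nmodType) (I : {fset nat}) (f : I -> R) :
  \sum_(i : I) f i = \sum_(n \in [set: nat]) extend 0 f n.
Proof.
rewrite (fsbigE (enum_fset I)) ?fset_uniq//.
  rewrite [RHS]big_mkcond big_seq_fsetE/=; apply: eq_bigr => i _.
  by rewrite in_setT /extend valK.
by move=> n _ nI; rewrite extend_out //; apply/negP.
Qed.

(** Sums over two different index sets can be compared term by term over the
natural numbers. *)
Lemma eq_sum_extend (R : nmodType) (I I' : {fset nat}) (f : I -> R)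
    (f' : I' -> R) :
  extend 0 f =1 extend 0 f' -> \sum_(i : I) f i = \sum_(i : I') f' i.
Proof. by rewrite !sum_extend => /funext ->. Qed.

(** * Lifts of plots and the metric on the Milnor space *)

Section Lifts.
Variables (R : realType) (d : nat) (G : lieGroupType R d).
Variable m : riemannian_metric G.

Lemma psi_eq (I I' : {fset nat}) (z : sphere R I * (I -> G))
    (z' : sphere R I' * (I' -> G)) :
  psi z = psi z' ->
  extend 0 z.1 = extend 0 z'.1 /\
  forall n, extend 0 z.1 n != 0 -> extend 1%g z.2 n = extend 1%g z'.2 n.
Proof. by move=> /eqmodP/asboolP. Qed.

Lemma smooth_lift_sub (n : nat) (U V : set 'rV[R]_n) (I : {fset nat})
    (q : 'rV[R]_n -> sphere R I * (I -> G)) :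
  V `<=` U -> smooth_lift U q -> smooth_lift V q.
Proof.
move=> VU [q1 q2]; split=> i; last exact: smooth_into_sub (q2 i).
by move=> k; apply: Ck_sub (q1 i k).
Qed.

Lemma extend_lift_differentiable (n : nat) (U : set 'rV[R]_n) (I : {fset nat})
    (q : 'rV[R]_n -> sphere R I * (I -> G)) u j :
  smooth_lift U q -> U u ->
  differentiable (fun t => extend 0 (q t).1 j : R) u.
Proof.
move=> [q1 _] Uu; have [jI|jI] := boolP (j \in I).
  have -> : (fun t => extend 0 (q t).1 j : R) = fun t => (q t).1 [` jI]%fset.
    by apply: funext => t; rewrite extend_in.
  exact: (q1 _ 1%N).1.
rewrite (_ : (fun t => _) = cst 0); first exact: differentiable_cst.
by apply: funext => t; rewrite extend_out.
Qed.

(** The right-hand side depends on the lift only through the coordinate functions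
of the underlying plot. *)
Lemma extend_diff_coord (n : nat) (I : {fset nat})
    (q : 'rV[R]_n -> sphere R I * (I -> G)) (u v w : 'rV[R]_n) j :
  extend 0 (fun i : I => 'd (fun t => (q t).1 i) u v *
                         'd (fun t => (q t).1 i) u w) j =
  'd (fun t => extend 0 (q t).1 j : R) u v *
  'd (fun t => extend 0 (q t).1 j : R) u w.
Proof.
have [jI|jI] := boolP (j \in I).
  rewrite extend_in.
  have -> // : (fun t => extend 0 (q t).1 j : R) = fun t => (q t).1 [` jI]%fset.
  by apply: funext => t; rewrite extend_in.
rewrite extend_out //.
rewrite (_ : (fun t => _) = cst 0); last first.
  by apply: funext => t; rewrite extend_out.
by rewrite (congr1 (@^~ v) (diff_cst _ _)) mul0r.
Qed.

(** The terms of the two pullbacks are compared for each natural number j.  The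
coordinate parts agree because the coordinate functions do.  The group parts
carry the factor x_j(u)^2: either it is zero, or x_j does not vanish near u, and
there the relation defining the quotient identifies the j-th group elements. *)
Lemma pullback_metric_unique (n : nat) (V : set 'rV[R]_n) (I I' : {fset nat})
    (q : 'rV[R]_n -> sphere R I * (I -> G))
    (q' : 'rV[R]_n -> sphere R I' * (I' -> G)) (u v w : 'rV[R]_n) :
  open V -> V u -> smooth_lift V q -> smooth_lift V q' ->
  (forall t, V t -> psi (q t) = psi (q' t)) ->
  pullback_metric m q u v w = pullback_metric m q' u v w.
Proof.
move=> oV Vu sq sq' qq'.
have eqx t : V t -> extend 0 (q t).1 = extend 0 (q' t).1.
  by move=> /qq'/psi_eq[].
congr (_ + _); apply: eq_sum_extend => j /=.
  rewrite !extend_diff_coord.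
  have dx := extend_lift_differentiable j sq Vu.
  have [_ dxx'] : differentiable (fun t => extend 0 (q' t).1 j : R) u /\
      'd (fun t => extend 0 (q' t).1 j : R) u
      = 'd (fun t => extend 0 (q t).1 j : R) u :> ('rV[R]_n -> R).
    by apply: open_eq_diff oV Vu _ dx => t /eqx ->.
  exact/esym/(congr2 _ (congr1 (@^~ v) dxx') (congr1 (@^~ w) dxx')).
pose x := extend 0 (q u).1 j : R.
(* This case covers each j outside I or outside I'. *)
have [x0|xN0] := eqVneq x 0.
  have vanish (J : {fset nat}) (y : J -> R) (F : J -> R) :
      extend 0 y j = 0 -> extend 0 (fun i => y i ^+ 2 * F i) j = 0.
    rewrite /extend; case: insubP => // i _ _ ->.
    by rewrite expr0n mul0r.
  by rewrite !vanish // -eqx.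
have jI : j \in I.
  by apply: contraNT xN0 => jI; rewrite /x extend_out.
have jI' : j \in I'.
  by apply: contraNT xN0 => jI'; rewrite /x eqx // extend_out.
pose i := [` jI]%fset; pose i' := [` jI']%fset.
have eqxi t : V t -> (q t).1 i = (q' t).1 i'.
  by move=> /eqx /(congr1 (@^~ j)); rewrite !extend_in.
(* x_j <> 0 is an open condition, by continuity of x_j. *)
have near_g : \forall t \near u, (q t).2 i = (q' t).2 i'.
  have near_x : \forall t \near u, extend 0 (q t).1 j != 0.
    have cx := differentiable_continuous (extend_lift_differentiable j sq Vu).
    apply: (cx [set y : R | y != 0]).
    by apply: open_nbhs_nbhs; split=> //; exact: open_neq.
  apply: filterS2 near_x (open_nbhs_nbhs (conj oV Vu)) => t xt /qq'/psi_eq[_ /(_ j xt)].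
  by rewrite !extend_in.
rewrite (extend_in _ _ jI) (extend_in _ _ jI') -/i -/i' (eqxi u Vu).
apply: (congr1 ( *%R _)).
apply: metric_congr; first exact: nbhs_singleton near_g.
  exact/esym/(differential_into_near_eq v (sq.2 i) Vu near_g).
exact/esym/(differential_into_near_eq w (sq.2 i) Vu near_g).
Qed.

Lemma pullback_metric_tensor (n : nat) (V : set 'rV[R]_n) (I : {fset nat})
    (q : 'rV[R]_n -> sphere R I * (I -> G)) :
  open V -> smooth_lift V q -> symmetric_2tensor V (pullback_metric m q).
Proof.
move=> oV [q1 q2]; split=> [u Vu|v w k].
  split=> [a v v' w|v w].
    rewrite /pullback_metric /product_metric /= mulrDr !mulr_sumr addrACA.
    congr (_ + _); rewrite -big_split /=; apply: eq_bigr => i _.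
      by rewrite linearP mulrDl -mulrA.
    rewrite /differential_into linearP.
    by rewrite (metric_bilinear m ((q u).2 i)).1 mulrDr mulrCA.
  rewrite /pullback_metric /product_metric /=.
  congr (_ + _); apply: eq_bigr => i _; first by rewrite mulrC.
  by rewrite (metric_bilinear m ((q u).2 i)).2.
apply: (CkD oV); apply: (Ck_sum _ oV) => i.
  exact: Ck_scale oV ((q1 i k.+1).2 v) ((q1 i k.+1).2 w).
apply: (Ck_scale oV); last exact: smooth_metric_along.
exact: Ck_scale oV (q1 i k) (q1 i k).
Qed.

Lemma smooth_lift_comp (n k : nat) (V : set 'rV[R]_n) (W : set 'rV[R]_k)
    (I : {fset nat}) (q : 'rV[R]_n -> sphere R I * (I -> G))
    (f : 'rV[R]_k -> 'rV[R]_n) :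
  open V -> open W -> smooth W f -> smooth_lift V q ->
  smooth_lift (W `&` f @^-1` V) (q \o f).
Proof.
move=> oV oW sf [q1 q2]; have oWV := open_preimage oW oV (sf 0%N).
split=> i.
  move=> j; apply: (Ck_comp oWV _ _ (q1 i j)) => [s []//|].
  by apply: Ck_sub (sf j) => s [].
have [q2c q2s] := q2 i.
have cfc s : (W `&` f @^-1` V) s -> {for s, continuous (fun t => (q (f t)).2 i)}.
  move=> [Ws Vs].
  exact: (@continuous_comp _ _ _ f (fun t => (q t).2 i) s
    (sf 0%N s Ws) (q2c _ Vs)).
split=> // c Ac j.
apply: (Ck_comp (open_preimage oWV (@chart_dom_open _ _ _ c) cfc) _ _ (q2s c Ac j)).
  by move=> s [[]].
by apply: Ck_sub (sf j) => s [[]].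
Qed.

Lemma pullback_metric_comp (n k : nat) (V : set 'rV[R]_n)
    (I : {fset nat}) (q : 'rV[R]_n -> sphere R I * (I -> G))
    (f : 'rV[R]_k -> 'rV[R]_n) (s v w : 'rV[R]_k) :
  smooth_lift V q -> V (f s) -> differentiable f s ->
  pullback_metric m (q \o f) s v w =
  pullback_metric m q (f s) ('d f s v) ('d f s w).
Proof.
move=> [q1 q2] Vs df; congr (_ + _); apply: eq_bigr => i _.
  have dcomp := diff_comp df ((q1 i 1%N).1 _ Vs).
  exact: congr2 _ (congr1 (@^~ v) dcomp) (congr1 (@^~ w) dcomp).
congr (_ * _); apply: metric_congr => //.
  exact: differential_into_comp (q2 i) Vs df.
exact: differential_into_comp (q2 i) Vs df.
Qed.

(** Independent of the domain of the plot, so that the value of the metric at a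
point depends only on the germ of the plot. *)
Definition lifts_near (n : nat) (p : 'rV[R]_n -> milnor_sphere R G)
    (u : 'rV[R]_n) (I : {fset nat})
    (q : 'rV[R]_n -> sphere R I * (I -> G)) : Prop :=
  exists V, [/\ open V, V u, smooth_lift V q & forall t, V t -> p t = psi (q t)].

(** The set has exactly one element as soon as p has a lift near u; the value 0 is
taken at the other points. *)
Definition milnor_metric : plot_assignment G := fun n _ p u v w =>
  xget 0 [set r | exists I (q : 'rV[R]_n -> sphere R I * (I -> G)),
                    lifts_near p u q /\ r = pullback_metric m q u v w].

Lemma milnor_metricE (n : nat) (U : set 'rV[R]_n)
    (p : 'rV[R]_n -> milnor_sphere R G) (u : 'rV[R]_n) (I : {fset nat})
    (q : 'rV[R]_n -> sphere R I * (I -> G)) :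
  lifts_near p u q ->
  milnor_metric U p u = pullback_metric m q u.
Proof.
move=> pq; apply: funext => v; apply: funext => w.
rewrite /milnor_metric; case: xgetP => [r _ [I' [q' [[V' [oV' Vu' sq' pq']]]]]|].
  move=> ->; have [V [oV Vu sq {}pq]] := pq.
  apply: (pullback_metric_unique (V := V `&` V')) => //.
  - exact: openI.
  - by apply: smooth_lift_sub sq' => t [].
  - by apply: smooth_lift_sub sq => t [].
  - by move=> t [Vt V't]; rewrite -pq // -pq'.
by move=> /(_ (pullback_metric m q u v w))[]; exists I, q.
Qed.

End Lifts.

Theorem corollary6p5 (R : realType) (d : nat) (G : lieGroupType R d)
    (m : riemannian_metric G) (hm : right_invariant m) :
  exists g : plot_assignment G,
    [/\ tensorial g,
        reparametrization_compatible g,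
        restricts_to_pullback m g
      & forall g' : plot_assignment G, restricts_to_pullback m g' ->
          forall (n : nat) (U : set 'rV[R]_n)
            (p : 'rV[R]_n -> milnor_sphere R G), plot U p ->
          forall u, U u -> forall v w : 'rV[R]_n, g' n U p u v w = g n U p u v w].
Proof.
exists (milnor_metric m).
have restr : restricts_to_pullback m (milnor_metric m).
  move=> n U V p I q pU oV VU sq pq u Vu v w.
  by rewrite (@milnor_metricE _ _ _ _ _ _ _ _ _ q) //; exists V.
split=> //.
- move=> n U p [oU loc]; split=> [u Uu|v w k].
    have [V [I [q [oV Vu VU sq pq]]]] := loc u Uu.
    rewrite (@milnor_metricE _ _ _ _ _ _ _ _ _ q); last by exists V.
    exact: (pullback_metric_tensor m oV sq).1.
  apply: Ck_local => u /loc[V [I [q [oV Vu VU sq pq]]]]; exists V => //.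
  apply: Ck_eq ((pullback_metric_tensor m oV sq).2 v w k) => // t Vt.
  by rewrite (@milnor_metricE _ _ _ _ _ _ _ _ _ q) //; exists V.
- move=> n k U W p f [oU loc] oW sf fWU s Ws v w.
  have [|V [I [q [oV Vs VU sq pq]]]] := loc (f s).
    by apply: fWU; exists s.
  rewrite (@milnor_metricE _ _ _ _ _ U _ _ _ q); last by exists V.
  rewrite (@milnor_metricE _ _ _ _ _ W _ _ _ (q \o f)); last first.
    exists (W `&` f @^-1` V); split=> //.
    + exact: open_preimage (sf 0%N).
    + exact: smooth_lift_comp.
    + by move=> t [_ Vt]; exact: pq.
  exact: pullback_metric_comp sq Vs ((sf 1%N).1 s Ws).
move=> g' g'restr n U p pU u Uu v w.
have [V [I [q [oV Vu VU sq pq]]]] := pU.2 u Uu.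
by rewrite (g'restr n U V p I q) // (restr n U V p I q).
Qed.
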